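(* Let $L$ be a solvable finite-dimensional Lie algebra over a field $F$. Then the prefrattini subalgebras of $L$ are precisely the subalgebras of the form $\bigcap_{j} K_j$, where $C_j/R_j$ runs over the distinct crowns of $L$ and, for each $j$, $K_j$ is a subalgebra of $L$ with $R_j \subseteq K_j$ such that $K_j/R_j$ is a complement of $C_j/R_j$ in $L/R_j$ (one complement being taken from each crown).
   Context: A chief factor of $L$ is $A/B$ with $B\subsetneq A$ ideals and no ideal strictly between; $C_L(A/B) = \{x : [x,A]\subseteq B\}$. $\phi(X)$ is the largest ideal of $X$ contained in the intersection of all maximal subalgebras of $X$; $A/B$ is a Frattini chief factor if $A/B\subseteq\phi(L/B)$. A subalgebra $M$ supplements $A/B$ if $L = A+M$ and $B\subseteq A\cap M$. The core $M_L$ is the largest ideal of $L$ in $M$; $L$ is primitive if some maximal subalgebra has zero core; monolithic if it has a unique minimal ideal; primitive of type 3 if it has exactly two distinct minimal ideals, both non-abelian. Chief factors are $L$-connected if they are isomorphic as $L$-modules or there is an ideal $N$ with $L/N$ primitive of type 3 whose two minimal ideals are $L$-isomorphic to them respectively. The crown associated with a supplemented chief factor $A/B$ is $C/R$ with $C = A + C_L(A/B)$ and $R$ the intersection of all $M_L$, $M$ a maximal subalgebra with $L/M_L$ monolithic and primitive supplementing a chief factor $L$-connected to $A/B$; the crowns of $L$ are the crowns associated with its supplemented chief factors. Prefrattini subalgebras: fix a chief series $0 = L_0 \subset L_1 \subset \cdots \subset L_n = L$; let $\mathcal{I}$ be the set of $i$ such that $L_i/L_{i-1}$ is not a Frattini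 chief factor, and for $i\in\mathcal{I}$ let $\mathcal{M}_i$ be the set of maximal subalgebras $M$ of $L$ with $L_{i-1}\subseteq M$ and $L_i\not\subseteq M$. A subalgebra $B$ is prefrattini if $B = \bigcap_{i\in\mathcal{I}} M_i$ for some choice of $M_i \in \mathcal{M}_i$ (this family does not depend on the chosen chief series). *)

(* Defs.v *)
From HB Require Import structures.
From mathcomp Require Import all_boot all_order all_algebra.
Set Implicit Arguments. Unset Strict Implicit. Unset Printing Implicit Defensive.
Import GRing.Theory.
Local Open Scope ring_scope.

Section LieDefs.
Variables (F : fieldType) (L : vectType F) (br : L -> L -> L).

Definition lie_algebra : Prop :=
  [/\ forall (a : F) (x y z : L), br (a *: x + y) z = a *: br x z + br y z,
      forall (a : F) (x y z : L), br z (a *: x + y) = a *: br z x + br z y,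
      forall x : L, br x x = 0
    & forall x y z : L, br x (br y z) + br y (br z x) + br z (br x y) = 0].

(* [U,V] = span of all brackets [u,v] (by bilinearity, span of basis brackets) *)
Definition brs (U V : {vspace L}) : {vspace L} :=
  (\sum_(u <- vbasis U) \sum_(v <- vbasis V) <[br u v]>)%VS.

Definition derived (k : nat) : {vspace L} := iter k (fun U => brs U U) fullv.

Definition solvable : Prop := exists k, derived k = 0%VS.

Definition subalg (S : {vspace L}) : Prop :=
  forall x y, x \in S -> y \in S -> br x y \in S.

Definition ideal (I : {vspace L}) : Prop :=
  forall x y, y \in I -> br x y \in I.

Definition maxsub (M : {vspace L}) : Prop :=
  [/\ subalg M, M != fullv &
      forall S, subalg S -> (M <= S)%VS -> S = M \/ S = fullv].

Definition is_core (M C : {vspace L}) : Prop :=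
  [/\ ideal C, (C <= M)%VS & forall I, ideal I -> (I <= M)%VS -> (I <= C)%VS].

Definition chief (A B : {vspace L}) : Prop :=
  [/\ ideal A, ideal B, (B <= A)%VS, B != A &
      forall I, ideal I -> (B <= I)%VS -> (I <= A)%VS -> I = B \/ I = A].

Definition is_centr (A B Z : {vspace L}) : Prop :=
  forall x, x \in Z <-> (forall a, a \in A -> br x a \in B).

(* P/B = phi(L/B), via the correspondence between subalgebras (ideals) of
   L/B and subalgebras (ideals) of L containing B. *)
Definition is_phi_quot (B P : {vspace L}) : Prop :=
  [/\ ideal P, (B <= P)%VS,
      (forall M, maxsub M -> (B <= M)%VS -> (P <= M)%VS) &
      forall I, ideal I -> (B <= I)%VS ->
        (forall M, maxsub M -> (B <= M)%VS -> (I <= M)%VS) -> (I <= P)%VS].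

Definition frattini_factor (A B : {vspace L}) : Prop :=
  chief A B /\ exists P, is_phi_quot B P /\ (A <= P)%VS.

Definition supplements (M A B : {vspace L}) : Prop :=
  [/\ subalg M, (A + M)%VS = fullv & (B <= A :&: M)%VS].

Definition supplemented (A B : {vspace L}) : Prop :=
  exists M, maxsub M /\ supplements M A B.

(* A1/B1 and A2/B2 are isomorphic as L-modules: there is a linear map f
   inducing an L-equivariant linear bijection A1/B1 -> A2/B2. *)
Definition L_iso (A1 B1 A2 B2 : {vspace L}) : Prop :=
  exists f : 'End(L),
  [/\ (f @: A1 <= A2)%VS, (f @: B1 <= B2)%VS,
      (forall a, a \in A1 -> f a \in B2 -> a \in B1),
      (A2 <= f @: A1 + B2)%VS &
      (forall x a, a \in A1 -> f (br x a) - br x (f a) \in B2)].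

Definition primitive_quot (N : {vspace L}) : Prop :=
  exists M, [/\ maxsub M, (N <= M)%VS & is_core M N].

Definition monolithic_quot (N : {vspace L}) : Prop :=
  exists I, chief I N /\ forall J, chief J N -> J = I.

Definition primitive_type3_quot (N I1 I2 : {vspace L}) : Prop :=
  [/\ primitive_quot N, I1 != I2, chief I1 N, chief I2 N &
      (forall J, chief J N -> J = I1 \/ J = I2)] /\
  (~ (brs I1 I1 <= N)%VS /\ ~ (brs I2 I2 <= N)%VS).

Definition L_connected (A1 B1 A2 B2 : {vspace L}) : Prop :=
  L_iso A1 B1 A2 B2 \/
  exists N I1 I2, [/\ ideal N, primitive_type3_quot N I1 I2,
                      L_iso I1 N A1 B1 & L_iso I2 N A2 B2].

Definition crown_max (A B M : {vspace L}) : Prop :=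
  [/\ maxsub M,
      (exists K, [/\ is_core M K, monolithic_quot K & primitive_quot K]) &
      exists A' B', [/\ chief A' B', L_connected A' B' A B & supplements M A' B']].

Definition crown_of (A B C R : {vspace L}) : Prop :=
  [/\ chief A B, supplemented A B,
      (exists Z, is_centr A B Z /\ C = (A + Z)%VS) &
      (forall x, x \in R <->
         (forall M K, crown_max A B M -> is_core M K -> x \in K))].

Definition is_crown (C R : {vspace L}) : Prop :=
  exists A B, crown_of A B C R.

Definition complement_quot (C R K : {vspace L}) : Prop :=
  [/\ subalg K, (R <= K)%VS, (K + C)%VS = fullv & (K :&: C)%VS = R].

Definition chief_series (n : nat) (s : nat -> {vspace L}) : Prop :=
  [/\ s 0%N = 0%VS, s n = fullv & forall i, (i < n)%N -> chief (s i.+1) (s i)].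

Definition prefrattini (n : nat) (s : nat -> {vspace L}) (B : {vspace L}) : Prop :=
  exists Ms : nat -> {vspace L},
    (forall i, (i < n)%N -> ~ frattini_factor (s i.+1) (s i) ->
       [/\ maxsub (Ms i), (s i <= Ms i)%VS & ~ (s i.+1 <= Ms i)%VS]) /\
    (forall x, x \in B <->
       (forall i, (i < n)%N -> ~ frattini_factor (s i.+1) (s i) -> x \in Ms i)).

End LieDefs.

(* Main.v *)
(* In a solvable Lie algebra chief factors are abelian, so type 3 primitive
   quotients do not occur, connectedness is L-isomorphism, and the crown of A/B
   is C/R where C = C_L(A/B) and R is the intersection of the cores K of the
   maximal subalgebras M complementing a factor isomorphic to A/B; for each of
   them C/K is chief, isomorphic to A/B, and C :&: M = K.

   The key fact is that, for maximal subalgebras M_i complementing the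
   non-Frattini factors of a chief series, the cores of those M_i whose factor
   has crown C/R meet, inside C, in R. Granting it, the intersection of these M_i
   complements C/R; conversely a complement H of C/R is the intersection of the
   maximal subalgebras H + core(M_i). *)
Require Import Defs.
From HB Require Import structures.
From mathcomp Require Import all_boot all_order all_algebra.
From Stdlib Require Import Classical IndefiniteDescription.
Set Implicit Arguments. Unset Strict Implicit. Unset Printing Implicit Defensive.
Import GRing.Theory.
Local Open Scope ring_scope.

(** * Extremal subspaces and subspaces cut out by predicates *)

Section Subspaces.
Variables (F : fieldType) (L : vectType F).
Implicit Types (U V W : {vspace L}) (P : {vspace L} -> Prop).

(** Induction on the codimension of [U]: finite dimension takes the place of Zorn's lemma, for
    arbitrary predicates. *)
Lemma exists_max_vspace P U : P U ->
  exists2 V, P V & forall W, P W -> (V <= W)%VS -> W = V.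
Proof.
have [m] := ubnP (\dim {:L} - \dim U); elim: m U => // m IH U ltUm PU.
case: (classic (exists2 W, P W & (U <= W)%VS /\ W <> U)) => [[W PW [sUW nWU]]|noW].
  apply: (IH W) => //; rewrite -ltnS; apply: leq_trans ltUm; rewrite ltnS.
  have ltUW : (\dim U < \dim W)%N.
    rewrite ltn_neqAle dimvS // andbT; apply/eqP => eqd; apply: nWU.
    by apply/eqP; rewrite eq_sym eqEdim sUW eqd leqnn.
  by apply: ltn_sub2l => //; apply: leq_trans ltUW _; apply: dimvS; apply: subvf.
exists U => // W PW sUW; apply: NNPP => nWU; apply: noW.
by exists W.
Qed.

Lemma exists_min_vspace P U : P U ->
  exists2 V, P V & forall W, P W -> (W <= V)%VS -> W = V.
Proof.
have [m] := ubnP (\dim U); elim: m U => // m IH U ltUm PU.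
case: (classic (exists2 W, P W & (W <= U)%VS /\ W <> U)) => [[W PW [sWU nWU]]|noW].
  apply: (IH W) => //; rewrite -ltnS; apply: leq_trans ltUm; rewrite ltnS.
  rewrite ltn_neqAle dimvS // andbT; apply/eqP => eqd; apply: nWU.
  by apply/eqP; rewrite eqEdim sWU eqd leqnn.
exists U => // W PW sWU; apply: NNPP => nWU; apply: noW.
by exists W.
Qed.

(** A maximal subspace [V] inside [Q] contains every [x] with [Q x], since [<[x]> + V] still lies in
    [Q]. This turns centralizers and arbitrary intersections into subspaces. *)
Lemma exists_vspace (Q : L -> Prop) :
  Q 0 -> (forall (a : F) x y, Q x -> Q y -> Q (a *: x + y)) ->
  exists V : {vspace L}, forall x, x \in V <-> Q x.
Proof.
move=> Q0 Ql.
have [|V QV maxV] := @exists_max_vspace (fun V => forall x, x \in V -> Q x) 0%VS.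
  by move=> x; rewrite memv0 => /eqP ->.
exists V => x; split=> [/QV //|Qx].
suff <- : (<[x]> + V)%VS = V by rewrite (subvP (addvSl _ _)) ?memv_line.
apply: maxV; last exact: addvSr.
by move=> z /memv_addP[_ /vlineP[a ->] [v /QV Qv ->]]; apply: Ql.
Qed.

Lemma exists_bigcap P :
  exists V : {vspace L}, forall x, x \in V <-> (forall U, P U -> x \in U).
Proof.
apply: exists_vspace => [U _|a x y Qx Qy U PU]; first exact: mem0v.
by rewrite memvD ?memvZ ?Qx ?Qy.
Qed.

End Subspaces.

(** * Ideals, subalgebras, cores and centralizers *)

Section LieAlgebra.
Variables (F : fieldType) (L : vectType F) (br : L -> L -> L).
Hypothesis hL : lie_algebra br.
Implicit Types (A B C I J K M N R S U V W Z : {vspace L}).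

Let brDl x y z : br (x + y) z = br x z + br y z.
Proof. by case: hL => H _ _ _; have := H 1 x y z; rewrite !scale1r. Qed.
Let brDr x y z : br z (x + y) = br z x + br z y.
Proof. by case: hL => _ H _ _; have := H 1 x y z; rewrite !scale1r. Qed.
Let br0l z : br 0 z = 0.
Proof. by apply: (addrI (br 0 z)); rewrite -brDl !addr0. Qed.
Let br0r z : br z 0 = 0.
Proof. by apply: (addrI (br z 0)); rewrite -brDr !addr0. Qed.
Let brZl a x z : br (a *: x) z = a *: br x z.
Proof. by case: hL => H _ _ _; have := H a x 0 z; rewrite br0l !addr0. Qed.
Let brZr a x z : br z (a *: x) = a *: br z x.
Proof. by case: hL => _ H _ _; have := H a x 0 z; rewrite br0r !addr0. Qed.
Let brC x y : br x y = - br y x.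
Proof.
case: hL => _ _ H _; apply/eqP; rewrite -addr_eq0.
by have := H (x + y); rewrite brDl !brDr !H addr0 add0r => ->.
Qed.
Let brNr x z : br z (- x) = - br z x.
Proof. by rewrite -scaleN1r brZr scaleN1r. Qed.
Let brBr x y z : br z (x - y) = br z x - br z y.
Proof. by rewrite brDr brNr. Qed.

Lemma idealr I x y : ideal br I -> x \in I -> br x y \in I.
Proof. by move=> hI xI; rewrite brC memvN hI. Qed.

Lemma ideal_subalg I : ideal br I -> subalg br I.
Proof. by move=> hI x y _; apply: hI. Qed.

Lemma idealf : ideal br fullv.
Proof. by move=> x y _; apply: memvf. Qed.

Lemma idealD I J : ideal br I -> ideal br J -> ideal br (I + J).
Proof.
move=> hI hJ x y /memv_addP[u uI [v vJ ->]].
by rewrite brDr memv_add ?hI ?hJ.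
Qed.

Lemma idealI I J : ideal br I -> ideal br J -> ideal br (I :&: J).
Proof. by move=> hI hJ x y /memv_capP[yI yJ]; rewrite memv_cap hI ?hJ. Qed.

Lemma subalgI S S' : subalg br S -> subalg br S' -> subalg br (S :&: S').
Proof.
move=> hS hS' x y /memv_capP[xS xS'] /memv_capP[yS yS'].
by rewrite memv_cap hS ?hS'.
Qed.

Lemma subalgD S I : subalg br S -> ideal br I -> subalg br (S + I).
Proof.
move=> hS hI _ _ /memv_addP[s sS [i iI ->]] /memv_addP[t tS [j jI ->]].
rewrite brDl brDr -addrA memv_add ?hS //.
by apply: memvD; [exact: hI | exact: idealr].
Qed.

(** Serves to show that meets such as [Z :&: M] are ideals when the two summands of L preserve them
    for different reasons. *)
Lemma ideal_of_add S U V : (U + V)%VS = fullv ->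
  (forall x y, x \in U -> y \in S -> br x y \in S) ->
  (forall x y, x \in V -> y \in S -> br x y \in S) -> ideal br S.
Proof.
move=> UV hU hV x y yS.
have /memv_addP[u uU [v vV ->]] : x \in (U + V)%VS by rewrite UV memvf.
by rewrite brDl; apply: memvD; [exact: hU | exact: hV].
Qed.

Lemma core_exists M : exists K, is_core br M K.
Proof.
have [|K [hK sKM] maxK] :=
  @exists_max_vspace _ _ (fun K => ideal br K /\ (K <= M)%VS) 0%VS.
  by split; [move=> x y; rewrite memv0 => /eqP ->; rewrite br0r mem0v | exact: sub0v].
exists K; split=> // I hI sIM.
have <- : (K + I)%VS = K; last exact: addvSr.
apply: maxK; last exact: addvSl.
by split; [exact: idealD | rewrite subv_add sKM sIM].
Qed.

Lemma centr_exists A B : exists Z, is_centr br A B Z.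
Proof.
apply: (@exists_vspace _ _ (fun x => forall a, a \in A -> br x a \in B)).
  by move=> a _; rewrite br0l mem0v.
by move=> c x y Qx Qy a aA; rewrite brDl brZl memvD ?memvZ ?Qx ?Qy.
Qed.

Lemma maxsub_add M I : maxsub br M -> ideal br I -> ~ (I <= M)%VS ->
  (M + I)%VS = fullv.
Proof.
case=> hM _ maxM hI nIM.
have [eqM|//] := maxM (M + I)%VS (subalgD hM hI) (addvSl _ _).
by case: nIM; rewrite -eqM addvSr.
Qed.

Lemma exists_maxsub S : subalg br S -> S != fullv ->
  exists2 M, maxsub br M & (S <= M)%VS.
Proof.
move=> hS nS.
have [|M [hM nM sSM] maxM] := @exists_max_vspace _ _
  (fun M => [/\ subalg br M, M != fullv & (S <= M)%VS]) S; first by split.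
exists M => //; split=> // T hT sMT; case: (eqVneq T fullv) => [|nT]; first by right.
by left; apply: maxM => //; split=> //; apply: subv_trans sMT.
Qed.

(** * Bracket subspaces and the derived series *)

Lemma brs_sub U V W : (forall u v, u \in U -> v \in V -> br u v \in W) ->
  (brs br U V <= W)%VS.
Proof.
move=> H; rewrite /brs big_seq_cond.
apply: (big_ind (fun X => X <= W)%VS); [exact: sub0v | |].
  by move=> X Y sX sY; rewrite subv_add sX sY.
move=> u; rewrite andbT => ub; rewrite big_seq_cond.
apply: (big_ind (fun X => X <= W)%VS); [exact: sub0v | |].
  by move=> X Y sX sY; rewrite subv_add sX sY.
by move=> v; rewrite andbT => vb; rewrite -memvE H ?(vbasis_mem ub) ?(vbasis_mem vb).
Qed.

Lemma mem_brs U V u v : u \in U -> v \in V -> br u v \in brs br U V.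
Proof.
have sub_big (r : seq L) (G : L -> {vspace L}) x :
    x \in r -> (G x <= \sum_(y <- r) G y)%VS.
  elim: r => // y r IH; rewrite in_cons big_cons => /orP[/eqP <-|/IH sx].
    exact: addvSl.
  exact: subv_trans sx (addvSr _ _).
have base x y : x \in vbasis U -> y \in vbasis V -> br x y \in brs br U V.
  move=> xU yV; rewrite memvE; apply: subv_trans (sub_big _ _ _ xU).
  exact: (sub_big _ (fun v => <[br x v]>%VS) _ yV).
move=> uU vV; rewrite (coord_vbasis uU) (coord_vbasis vV).
(* Bilinear extension from basis vectors in two stages: [X] collects the left arguments that are
   good against the basis of [V], then [Y] the right arguments that are good against all of [X]. *)
have [X PX] : exists X : {vspace L}, forall x, x \in X <->
    forall y, y \in vbasis V -> br x y \in brs br U V.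
  apply: exists_vspace => [y _|a x x' Hx Hx' y yV]; first by rewrite br0l mem0v.
  by rewrite brDl brZl memvD ?memvZ ?Hx ?Hx'.
have [Y PY] : exists Y : {vspace L}, forall y, y \in Y <->
    forall x, x \in X -> br x y \in brs br U V.
  apply: exists_vspace => [y _|a x x' Hx Hx' y yV]; first by rewrite br0r mem0v.
  by rewrite brDr brZr memvD ?memvZ ?Hx ?Hx'.
have uX : \sum_i coord (vbasis U) i u *: (vbasis U)`_i \in X.
  apply: memv_suml => i _; apply/memvZ/PX => y yV.
  by apply: base => //; apply: mem_nth; rewrite size_tuple.
have vY : \sum_i coord (vbasis V) i v *: (vbasis V)`_i \in Y.
  apply: memv_suml => i _; apply/memvZ/PY => x /PX; apply.
  by apply: mem_nth; rewrite size_tuple.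
by move/PY: vY; apply.
Qed.

Lemma ideal_brs U V : ideal br U -> ideal br V -> ideal br (brs br U V).
Proof.
move=> hU hV.
(* [W] is the subspace of elements that every [br x] sends into [brs br U V]. By Jacobi [br x] is a
   derivation, so [W] contains all brackets of [U] with [V]. *)
have [W PW] : exists W : {vspace L}, forall y, y \in W <->
    forall x, br x y \in brs br U V.
  apply: exists_vspace => [x|a x x' Hx Hx' y]; first by rewrite br0r mem0v.
  by rewrite brDr brZr memvD ?memvZ ?Hx ?Hx'.
have sW : (brs br U V <= W)%VS.
  apply: brs_sub => u v uU vV; apply/PW => x.
  have -> : br x (br u v) = br (br x u) v + br u (br x v).
    case: hL => _ _ _ /(_ x u v); rewrite -addrA => /eqP.
    rewrite addr_eq0 => /eqP ->.
    by rewrite (brC (br x u)) (brC x v) brNr opprD addrC.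
  by rewrite memvD // mem_brs ?hU ?hV.
by move=> x y /(subvP sW)/PW; apply.
Qed.

Lemma ideal_derived k : ideal br (derived br k).
Proof. by elim: k => [|k IH]; [exact: idealf | exact: ideal_brs]. Qed.

(** * Isomorphisms of factors as L-modules *)

(** The form in which the second isomorphism theorem is used: the inclusion induces the
    isomorphism. *)
Lemma L_iso_id A1 B1 A2 B2 : (A1 <= A2)%VS -> (B1 <= B2)%VS ->
  (A1 :&: B2 <= B1)%VS -> (A2 <= A1 + B2)%VS -> L_iso br A1 B1 A2 B2.
Proof.
move=> sA sB sAB sAA; exists \1%VF; rewrite !lim1g; split=> //.
  by move=> a aA1; rewrite id_lfunE => aB2; rewrite (subvP sAB) // memv_cap aA1.
by move=> x a _; rewrite !id_lfunE subrr mem0v.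
Qed.

Lemma L_iso_trans A1 B1 A2 B2 A3 B3 :
  L_iso br A1 B1 A2 B2 -> L_iso br A2 B2 A3 B3 -> L_iso br A1 B1 A3 B3.
Proof.
move=> [f [/subvP fA /subvP fB fI /subvP fS fE]] [g [/subvP gA /subvP gB gI /subvP gS gE]].
have fA' a : a \in A1 -> f a \in A2 by move=> aA; apply/fA/memv_img.
have gA' a : a \in A2 -> g a \in A3 by move=> aA; apply/gA/memv_img.
have fB' a : a \in B1 -> f a \in B2 by move=> aA; apply/fB/memv_img.
have gB' a : a \in B2 -> g a \in B3 by move=> aA; apply/gB/memv_img.
exists (g \o f)%VF; split.
- by apply/subvP=> _ /memv_imgP[a aA ->]; rewrite lfunE /= gA' ?fA'.
- by apply/subvP=> _ /memv_imgP[a aA ->]; rewrite lfunE /= gB' ?fB'.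
- by move=> a aA; rewrite lfunE /= => gfa; apply: fI => //; apply: gI; rewrite ?fA'.
- apply/subvP => x /gS /memv_addP[_ /memv_imgP[y /fS yA ->] [b bB ->]].
  have /memv_addP[_ /memv_imgP[a aA ->] [c cB ->]] := yA.
  rewrite linearD /= -addrA; apply: memv_add; last by rewrite memvD ?gB'.
  by apply/memv_imgP; exists a; rewrite ?lfunE.
move=> x a aA; rewrite !lfunE /= -(subrK (g (br x (f a))) (g (f _))) -addrA.
by apply: memvD; [rewrite -linearB /=; apply/gB'/fE | apply/gE/fA'].
Qed.

Lemma L_iso_sym A1 B1 A2 B2 : ideal br A1 -> ideal br A2 -> ideal br B2 ->
  (B2 <= A2)%VS -> L_iso br A1 B1 A2 B2 -> L_iso br A2 B2 A1 B1.
Proof.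
move=> hA1 hA2 hB2 /subvP sBA [f [/subvP fA /subvP fB fI /subvP fS fE]].
have fA' a : a \in A1 -> f a \in A2 by move=> aA; apply/fA/memv_img.
have fB' a : a \in B1 -> f a \in B2 by move=> aA; apply/fB/memv_img.
(* g sends a in A2 to a preimage in A1 of the f @: A1 component of a. *)
pose h := (f \o projv A1)%VF.
pose g := (projv A1 \o h^-1 \o addv_pi1 (f @: A1) B2)%VF.
have gA a : g a \in A1 by rewrite lfunE /= lfunE /= memv_proj.
have gK a : a \in A2 -> f (g a) - a \in B2.
  move=> /fS aA2; rewrite -[X in _ - X](addv_pi1_pi2 aA2).
  have /memv_imgP[a1 a1A e1] := memv_pi1 (f @: A1)%VS B2 a.
  have -> : f (g a) = addv_pi1 (f @: A1) B2 a.
    rewrite /g !lfunE /= lfunE /=.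
    have -> u : f (projv A1 u) = h u by rewrite lfunE.
    apply: limg_lfunVK; rewrite e1.
    have -> : f a1 = h a1 by rewrite lfunE /= projv_id.
    exact/memv_img/memvf.
  by rewrite opprD addrA subrr sub0r memvN memv_pi2.
have gI a : a \in A2 -> f (g a) \in B2 -> a \in B2.
  by move=> aA fB2; rewrite -(subKr (f (g a)) a) memvB ?gK.
(* Congruences modulo [B1] for values of [g] can thus be checked after applying [f], where [gK]
   makes [f (g a)] congruent to [a]. *)
have I1 a1 a2 : a1 \in A1 -> a2 \in A1 -> f a1 - f a2 \in B2 -> a1 - a2 \in B1.
  by move=> a1A a2A fB2; apply: fI; rewrite ?memvB ?linearB.
exists g; split.
- by apply/subvP=> _ /memv_imgP[a _ ->].
- apply/subvP=> _ /memv_imgP[a aB ->]; apply: fI => //.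
  by rewrite -(subrK a (f _)) memvD ?gK ?sBA.
- by move=> a aA gB; apply: gI => //; apply: fB'.
- apply/subvP=> a aA; rewrite -(subrKC (g (f a)) a).
  apply: memv_add; first exact/memv_img/fA'.
  by apply: I1 => //; rewrite -opprB memvN gK ?fA'.
move=> x a aA; apply: I1; rewrite ?gA ?hA1 //.
have H1 : f (g (br x a)) - br x a \in B2 by apply/gK/hA2.
have H2 : f (br x (g a)) - br x (f (g a)) \in B2 by apply: fE.
have H3 : br x (f (g a)) - br x a \in B2 by rewrite -brBr hB2 ?gK.
have -> : f (g (br x a)) - f (br x (g a)) =
  (f (g (br x a)) - br x a) - ((f (br x (g a)) - br x (f (g a))) + (br x (f (g a)) - br x a)).
  by rewrite subrKA opprB addrA subrK.
by apply: memvB => //; apply: memvD.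
Qed.

Lemma L_iso_centr A1 B1 A2 B2 Z : ideal br A1 -> ideal br B2 ->
  L_iso br A1 B1 A2 B2 -> is_centr br A2 B2 Z -> is_centr br A1 B1 Z.
Proof.
move=> hA1 hB2 [f [/subvP fA /subvP fB fI /subvP fS fE]] hZ x.
have fA' a : a \in A1 -> f a \in A2 by move=> aA; apply/fA/memv_img.
have fB' a : a \in B1 -> f a \in B2 by move=> aA; apply/fB/memv_img.
split=> [/hZ H a aA | H].
  apply: fI; first exact: hA1.
  by rewrite -(subrK (br x (f a)) (f _)) memvD ?fE ?H ?fA'.
apply/hZ => a2 /fS/memv_addP[_ /memv_imgP[a aA ->] [b bB ->]].
rewrite brDr; apply: memvD; last exact: hB2.
by rewrite -(subKr (f (br x a)) (br x _)) memvB ?fE ?fB' ?H.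
Qed.

(** * Chief factors, their centralizers, and the effect of solvability *)

Lemma chief_cap A B I : chief br A B -> ideal br I -> (B <= I)%VS ->
  (A <= I)%VS \/ (A :&: I)%VS = B.
Proof.
case=> hA hB sBA _ hAB hI sBI.
have sB : (B <= A :&: I)%VS by rewrite subv_cap sBA.
have [|eA] := hAB _ (idealI hA hI) sB (capvSl _ _); first by right.
by left; rewrite -eA capvSr.
Qed.

Lemma centr_ideal A B Z : ideal br A -> ideal br B -> is_centr br A B Z -> ideal br Z.
Proof.
move=> hA hB hZ x z /hZ zZ; apply/hZ => a aA.
case: hL => _ _ _ /(_ x z a) /eqP; rewrite addr_eq0 => /eqP e.
rewrite brC -e; apply: memvD; first exact/hB/zZ.
by apply/zZ/idealr.
Qed.

Hypothesis hsol : solvable br.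

(** The derived series reaches 0, so there is a last [k] with [A] inside [derived br k + B]. Then
    [A,A] lies in both [A] and [derived br k.+1 + B], and these meet in [B] because A/B is chief. *)
Lemma chief_abelian A B x y : chief br A B -> x \in A -> y \in A -> br x y \in B.
Proof.
case=> hA hB sBA nBA hAB xA yA.
have [k [sAk nAk]] : exists k, (A <= derived br k + B)%VS /\ ~ (A <= derived br k.+1 + B)%VS.
  apply: NNPP => nk; case: hsol => m Dm.
  have sA k : (A <= derived br k + B)%VS.
    elim: k => [|k IH]; first by rewrite addvC; apply/(subv_trans (subvf _))/addvSr.
    by apply: NNPP => nA; apply: nk; exists k.
  by case/negP: nBA; rewrite eqEsubv sBA /=; have := sA m; rewrite Dm add0v.
pose D := (derived br k.+1 + B)%VS.
have hD : ideal br D by apply: idealD => //; apply: ideal_derived.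
have [//|<-] := chief_cap (And5 hA hB sBA nBA hAB) hD (addvSr _ _).
rewrite memv_cap hA //=.
have /memv_addP[d dD [b bB ->]] := subvP sAk _ xA.
have /memv_addP[d' dD' [b' bB' ->]] := subvP sAk _ yA.
rewrite brDl brDr -addrA; apply: memv_add; first exact: mem_brs.
by apply: memvD; [exact: hB | exact: idealr].
Qed.

Lemma type3_false N I1 I2 : ~ primitive_type3_quot br N I1 I2.
Proof.
case=> [[_ _ c1 _ _] [n1 _]]; apply: n1; apply: brs_sub => u v.
exact: chief_abelian.
Qed.

Lemma L_connectedE A1 B1 A2 B2 :
  L_connected br A1 B1 A2 B2 -> L_iso br A1 B1 A2 B2.
Proof. by case=> // -[N [I1 [I2 [_ /type3_false]]]]. Qed.


Lemma chief_sub_centr A B Z : chief br A B -> is_centr br A B Z -> (A <= Z)%VS.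
Proof.
by move=> cAB hZ; apply/subvP=> x xA; apply/hZ => a; apply: chief_abelian.
Qed.

(** * Maximal subalgebras, their cores and the factors they supplement *)

Lemma maxsub_nsub A M : maxsub br M -> (A + M)%VS = fullv -> ~ (A <= M)%VS.
Proof.
by move=> [_ /eqP nM _] AM sAM; apply: nM; rewrite -AM; apply/esym/addv_idPr.
Qed.

(** [Z :&: M] is preserved by [M] and, since [A,Z] lies in [B], also by [A]; so it is an ideal
    inside [M]. Conversely the core maps [A] into [A :&: M], which is [B], so it lies in [Z]. The
    modular law then gives the sum, and Z/K is A/B by the second isomorphism theorem. *)
Lemma maxsub_centr A B Z M K : chief br A B -> is_centr br A B Z ->
    maxsub br M -> (A + M)%VS = fullv -> (B <= M)%VS -> is_core br M K ->
  [/\ (Z :&: M)%VS = K, (A + K)%VS = Z, chief br Z K & L_iso br A B Z K].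
Proof.
move=> cAB hZ hM AM sBM [hK sKM maxK].
have [hA hB sBA nBA hAB] := cAB.
have sAZ := chief_sub_centr cAB hZ; have iZ := centr_ideal hA hB hZ.
have nAM := maxsub_nsub hM AM.
have sM : subalg br M by case: hM.
have iZM : ideal br (Z :&: M).
  apply: (ideal_of_add AM) => x y => [xA /memv_capP[/hZ yZ _]|xM /memv_capP[yZ yM]].
    have yxB := yZ _ xA; rewrite brC memvN memv_cap (subvP sBM) // andbT.
    exact/(subvP sAZ)/(subvP sBA).
  by rewrite memv_cap iZ ?sM.
have eqAM : (A :&: M)%VS = B.
  have iAM : ideal br (A :&: M).
    have -> : (A :&: M = A :&: (Z :&: M))%VS by rewrite capvA (capv_idPl sAZ).
    exact: idealI.
  have sB : (B <= A :&: M)%VS by rewrite subv_cap sBA.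
  have [sA|<-] := chief_cap cAB iAM sB; last by rewrite capvA capvv.
  by case: nAM; apply: subv_trans sA (capvSr _ _).
have eqZM : (Z :&: M)%VS = K.
  apply/eqP; rewrite eqEsubv maxK ?capvSr //= subv_cap sKM andbT.
  apply/subvP=> x xK; apply/hZ => a aA.
  by rewrite -eqAM memv_cap hA // (subvP sKM) // idealr.
have eqAK : (A + K)%VS = Z.
  by rewrite -eqZM capvC vspace_modl // AM capfv.
have sBK : (B <= K)%VS by rewrite maxK.
have sKZ : (K <= Z)%VS by rewrite -eqZM capvSl.
split=> //.
  split=> //; first by apply/eqP => eqKZ; apply: nAM; rewrite (subv_trans sAZ) -?eqKZ.
  move=> I hI sKI sIZ.
  have [sAI|eqAI] := chief_cap cAB hI (subv_trans sBK sKI).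
    by right; apply/eqP; rewrite eqEsubv sIZ -eqAK subv_add sAI.
  left; apply/eqP; rewrite eqEsubv sKI andbT -(capv_idPr sIZ) -eqAK addvC.
  by rewrite -vspace_modl // eqAI subv_add sBK subvv.
apply: L_iso_id => //; last by rewrite eqAK.
by rewrite -eqAM capvS.
Qed.

(** A chief factor J/K is its own centralizer, by [maxsub_centr] with [K] as bottom. Two different
    ones would meet in [K], hence centralize each other, hence be contained in one another. *)
Lemma maxsub_monolithic M K : maxsub br M -> is_core br M K -> monolithic_quot br K.
Proof.
move=> hM hKM; have [hK sKM maxK] := hKM.
have nKf : K != fullv.
  by case: hM => _ nM _; apply: contraNneq nM => eK; rewrite eqEsubv subvf -eK.
have [|A [hA sKA nKA] minA] := @exists_min_vspace _ _
  (fun A => [/\ ideal br A, (K <= A)%VS & K != A]) fullv.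
  by split; [exact: idealf | exact: subvf | ].
have cA : chief br A K.
  split=> // I hI sKI sIA; case: (eqVneq K I) => [->|nKI]; first by left.
  by right; apply: minA.
have chief_centr J : chief br J K -> is_centr br J K J.
  move=> cJ; have [Z hZ] := centr_exists J K.
  have [hJ _ sKJ nKJ _] := cJ.
  have nJM : ~ (J <= M)%VS.
    by move=> sJM; case/negP: nKJ; rewrite eqEsubv sKJ maxK.
  have JM : (J + M)%VS = fullv by rewrite addvC maxsub_add.
  have [_ eZ _ _] := maxsub_centr cJ hZ hM JM sKM hKM.
  by move: hZ; rewrite -eZ (addv_idPl sKJ).
exists A; split=> // J cJ; have [hJ _ sKJ nKJ hKJ] := cJ.
have [sAJ|eqAJ] := chief_cap cA hJ sKJ.
  by case: (hKJ A) => // eAK; case/eqP: nKA.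
suff sJA : (J <= A)%VS by rewrite (capv_idPr sJA) in eqAJ; rewrite eqAJ eqxx in nKJ.
apply/subvP=> x xJ; apply/(chief_centr A cA) => a aA.
by rewrite -eqAJ memv_cap hA // idealr.
Qed.

(** Links the two notions: the maximal subalgebras admissible at A/B for a prefrattini subalgebra
    are among those defining the crown of A/B. *)
Lemma maxsub_crown_max A B M : chief br A B -> maxsub br M -> (B <= M)%VS ->
  ~ (A <= M)%VS -> crown_max br A B M.
Proof.
move=> cAB hM sBM nAM; have [hA _ sBA _ _] := cAB; split=> //.
  have [K hK] := core_exists M; exists K; split=> //; first exact: maxsub_monolithic hK.
  by exists M; split=> //; case: hK.
exists A, B; split=> //; first by left; apply: L_iso_id; rewrite ?addvSl ?capvSr.
by split; [case: hM | rewrite addvC maxsub_add | rewrite subv_cap sBA].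
Qed.

(** * Existence and uniqueness of crowns; non-Frattini factors *)

Lemma crown_exists A B : chief br A B -> supplemented br A B ->
  exists C R, crown_of br A B C R.
Proof.
move=> cAB sAB; have [Z hZ] := centr_exists A B.
have [R hR] := exists_bigcap (fun K => exists2 M, crown_max br A B M & is_core br M K).
exists (A + Z)%VS, R; split=> //; first by exists Z.
move=> x; rewrite hR; split=> [H M K hM hK|H K [M hM hK]]; last exact: H hK.
by apply: H; exists M.
Qed.

Lemma crown_uniq A B C R C' R' :
  crown_of br A B C R -> crown_of br A B C' R' -> C = C' /\ R = R'.
Proof.
move=> [_ _ [Z [hZ ->]] hR] [_ _ [Z' [hZ' ->]] hR'].
have -> : Z = Z'.
  by apply/vspaceP=> x; apply/idP/idP => [/hZ/hZ'|/hZ'/hZ].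
by split=> //; apply/vspaceP=> x; apply/idP/idP => [/hR/hR'|/hR'/hR].
Qed.

Lemma frattini_factorN A B : chief br A B -> ~ frattini_factor br A B <->
  exists M, [/\ maxsub br M, (B <= M)%VS & ~ (A <= M)%VS].
Proof.
move=> cAB; have [hA hB sBA _ _] := cAB; split=> [nf|[M [hM sBM nAM]] [_ [P [[_ _ sP _] sAP]]]].
  apply: NNPP => nM; apply: nf; split=> //.
  have sup M : maxsub br M -> (B <= M)%VS -> (A <= M)%VS.
    by move=> hM sBM; apply: NNPP => nAM; apply: nM; exists M.
  (* If every maximal subalgebra over [B] contained [A], the largest ideal inside all of them, found
     by starting from [A], would be phi(L/B) and make A/B Frattini. *)
  have [|P [hP sBP sP] maxP] := @exists_max_vspace _ _
    (fun P => [/\ ideal br P, (B <= P)%VS & forall M, maxsub br M -> (B <= M)%VS -> (P <= M)%VS]) A.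
    by split.
  have big I : ideal br I -> (forall M, maxsub br M -> (B <= M)%VS -> (I <= M)%VS) -> (I <= P)%VS.
    move=> hI sI; rewrite -(maxP (P + I)%VS) ?addvSl ?addvSr //; split.
    - exact: idealD.
    - exact: subv_trans sBP (addvSl _ _).
    by move=> M hM sBM; rewrite subv_add sP ?sI.
  by exists P; split; [split=> // I hI _; apply: big | apply: big].
by apply: nAM; apply: subv_trans sAP _; apply: sP.
Qed.

Lemma is_crown_of A B C R : crown_of br A B C R -> is_crown br C R.
Proof. by move=> hC; exists A, B. Qed.

(** * Structure of a fixed crown *)

Section Crown.
Variables A B C R : {vspace L}.
Hypothesis hC : crown_of br A B C R.

Lemma crown_centr : is_centr br A B C.
Proof.
have [cAB _ [Z [hZ ->]] _] := hC.
by rewrite (addv_idPr (chief_sub_centr cAB hZ)).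
Qed.

(** Isomorphic factors have the same centralizer, so [maxsub_centr] for the factor A'/B' that [M]
    supplements speaks about [C] itself. *)
Lemma crown_core M K : crown_max br A B M -> is_core br M K ->
  [/\ (C :&: M)%VS = K, chief br C K, L_iso br A B C K & (R <= K)%VS].
Proof.
move=> hM hK; have [cAB _ _ hR] := hC.
have [hmM _ [A' [B' [cAB' /L_connectedE iso [_ AM]]]]] := hM.
rewrite subv_cap => /andP[_ sBM].
have [[hA hB sBA _ _] [hA' hB' sBA' _ _]] := (cAB, cAB').
have hZ : is_centr br A' B' C by apply: L_iso_centr iso crown_centr.
have [CM _ cCK iso'] := maxsub_centr cAB' hZ hmM AM sBM hK.
split=> //; first by apply: L_iso_trans iso'; apply: L_iso_sym iso.
by apply/subvP=> x /hR; apply; [exact: hM | ].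
Qed.

Lemma crown_core_exists : exists M K, crown_max br A B M /\ is_core br M K.
Proof.
have [cAB [M [hM [_ AM sBAM]]] _ _] := hC; move: sBAM; rewrite subv_cap => /andP[_ sBM].
have [K hK] := core_exists M; exists M, K; split=> //.
by apply: maxsub_crown_max => //; apply: maxsub_nsub.
Qed.

Lemma crown_sub : (R <= C)%VS.
Proof.
have [M [K [hM hK]]] := crown_core_exists.
have [_ [_ _ sKC _ _] _ sRK] := crown_core hM hK.
exact: subv_trans sKC.
Qed.

Lemma crown_ideal : ideal br C /\ ideal br R.
Proof.
have [[hA hB _ _ _] _ _ hR] := hC.
split; first exact: centr_ideal crown_centr.
by move=> x y /hR yR; apply/hR => M K hM hK; case: (hK) => iK _ _; apply/iK/(yR M).
Qed.

Lemma crown_abelian x y : x \in C -> y \in C -> br x y \in R.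
Proof.
have [_ _ _ hR] := hC; move=> xC yC; apply/hR => M K hM hK.
by have [_ cK _ _] := crown_core hM hK; apply: chief_abelian cK _ _.
Qed.

(* S is a minimal subalgebra with R <= S and S + Y = L: if the ideal S :&: Y were
   not inside some M, then S :&: M would be a smaller one. *)
Lemma crown_supplement Y : ideal br Y -> (Y <= C)%VS ->
  exists S, [/\ subalg br S, (R <= S)%VS, (S + Y)%VS = fullv & (S :&: Y <= R)%VS].
Proof.
move=> hY sYC; have [_ _ _ hR] := hC.
have [|S [hS sRS SY] minS] := @exists_min_vspace _ _
  (fun S => [/\ subalg br S, (R <= S)%VS & (S + Y)%VS = fullv]) fullv.
  by split; [apply/ideal_subalg/idealf | exact: subvf | exact/addv_idPl/subvf].
exists S; split=> //.
(* [S] preserves the meet because [Y] is an ideal; [Y] preserves it because C/R is abelian and [R]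
   lies in [S]. *)
have iSY : ideal br (S :&: Y).
  apply: (ideal_of_add SY) => x y => [xS|xY] /memv_capP[yS yY]; rewrite memv_cap.
    by rewrite hS ?hY.
  by rewrite hY ?(subvP sRS) ?crown_abelian ?(subvP sYC).
apply/subvP=> y yS; apply/hR => M K hM hK.
have [[hmM _ _] [hiK sKM maxK]] := (hM, hK).
apply: (subvP (maxK _ iSY _)) => //; apply: NNPP => nSM.
have MSY := maxsub_add hmM iSY nSM.
have eqS : (S :&: M + S :&: Y)%VS = S.
  by rewrite vspace_modr ?capvSl // MSY capvf.
have eqSM : (S :&: M)%VS = S.
  apply: minS; last exact: capvSl.
  split; first by apply: subalgI => //; case: hmM.
    have [_ _ _ sRK] := crown_core hM hK.
    by rewrite subv_cap sRS (subv_trans sRK).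
  apply/eqP; rewrite eqEsubv subvf -SY -{1}eqS -addvA subv_add addvSl.
  by rewrite subv_add addvSr (subv_trans (capvSr _ _)) ?addvSr.
by apply: nSM; rewrite -eqSM -capvA (capvC M) capvA capvSr.
Qed.

End Crown.

(** Both the centralizer and the family of maximal subalgebras depend only on the isomorphism class
    of the factor. *)
Lemma crown_of_iso A B A' B' C R : crown_of br A B C R -> chief br A' B' ->
  supplemented br A' B' -> L_iso br A' B' A B -> crown_of br A' B' C R.
Proof.
move=> hC cAB' sAB' iso; have [cAB _ _ hR] := hC.
have [[hA hB sBA _ _] [hA' hB' sBA' _ _]] := (cAB, cAB').
have iso' := L_iso_sym hA' hA hB sBA iso.
have hZ : is_centr br A' B' C := L_iso_centr hA' hB iso (crown_centr hC).
split=> //.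
  by exists C; rewrite (addv_idPr (chief_sub_centr cAB' hZ)).
suff eqM M : crown_max br A B M <-> crown_max br A' B' M.
  by move=> x; rewrite hR; split=> H M K /eqM hM; apply: H.
by split=> -[hM KM [D [E [cDE /L_connectedE isoDE sM]]]]; split=> //;
  exists D, E; split=> //; left; apply: L_iso_trans isoDE _.
Qed.

(** * Crowns along a chief series *)

Section ChiefSeries.
Variables (n : nat) (s : nat -> {vspace L}).
Hypothesis hs : chief_series br n s.

Let chief_s i : (i < n)%N -> chief br (s i.+1) (s i).
Proof. by case: hs => _ _; apply. Qed.

Lemma series_le i j : (i <= j <= n)%N -> (s i <= s j)%VS.
Proof.
elim: j => [|j IH]; first by rewrite leqn0 => /andP[/eqP -> _].
rewrite leq_eqVlt => /andP[/orP[/eqP -> //|leij] ltjn].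
apply: subv_trans (IH _) _; first by rewrite -ltnS leij ltnW.
by have [] := chief_s ltjn.
Qed.

Lemma factor_crown i : (i < n)%N -> ~ frattini_factor br (s i.+1) (s i) ->
  exists C R, crown_of br (s i.+1) (s i) C R.
Proof.
move=> ltin /(frattini_factorN (chief_s ltin))[M [hM sM nM]].
have [hS _ sS _ _] := chief_s ltin.
apply: crown_exists => //; first exact: chief_s.
exists M; split=> //; split; first by case: hM.
  by rewrite addvC maxsub_add.
by rewrite subv_cap sS.
Qed.

Definition prefrattini_choice (Ms : nat -> {vspace L}) :=
  forall i, (i < n)%N -> ~ frattini_factor br (s i.+1) (s i) ->
    [/\ maxsub br (Ms i), (s i <= Ms i)%VS & ~ (s i.+1 <= Ms i)%VS].

(* Let T be the intersection of C with these cores. If T is not inside R, take j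
   least with s j.+1 :&: T not inside R. Then s j.+1 / s j has crown C/R, and it is
   not Frattini, because a supplement S of s j.+1 with S :&: s j.+1 inside R yields
   a proper subalgebra S + s j supplementing s j.+1. So the core of Ms j contains T
   and s j, hence s j.+1, a contradiction. *)
Lemma crown_meet_cores Ms C R x : prefrattini_choice Ms -> is_crown br C R ->
    x \in C ->
    (forall i, (i < n)%N -> ~ frattini_factor br (s i.+1) (s i) ->
      crown_of br (s i.+1) (s i) C R ->
      forall K, is_core br (Ms i) K -> x \in K) ->
  x \in R.
Proof.
move=> hMs [A [B hC]] xC xK; have [cAB _ _ hR] := hC.
have [hA hB sBA _ _] := cAB.
have [iC iR] := crown_ideal hC.
(* [C] itself is put in the family, so that [T] lies in [C] even if no index has crown C/R. *)
have [T hT] := exists_bigcap (fun U => U = C \/ exists i,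
  [/\ (i < n)%N, ~ frattini_factor br (s i.+1) (s i),
      crown_of br (s i.+1) (s i) C R & is_core br (Ms i) U]).
have xT : x \in T.
  by apply/hT => U [->//|[i [ltin nfr cri hU]]]; apply: xK hU.
have sTC : (T <= C)%VS by apply/subvP=> y /hT; apply; left.
have sRT : (R <= T)%VS.
  apply/subvP=> y yR; apply/hT => U [->|[i [ltin nfr cri hU]]].
    exact: (subvP (crown_sub hC)).
  have [hMi sMi nMi] := hMs i ltin nfr.
  have [_ _ _ /subvP->] // := crown_core cri (maxsub_crown_max (chief_s ltin) hMi sMi nMi) hU.
have iT : ideal br T.
  move=> a y /hT yT; apply/hT => U hU.
  suff iU : ideal br U by apply/iU/yT.
  by case: hU => [->//|[i [_ _ _ []]]].
apply: NNPP => xR.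
have [|[|j] nsj minj] := @ex_minnP (fun k => ~~ (s k :&: T <= R)%VS).
- exists n; apply/negP => /subvP sTR; apply: xR; apply: sTR.
  by rewrite memv_cap xT; case: hs => _ -> _; rewrite memvf.
- by case/negP: nsj; case: hs => -> _ _; rewrite cap0v sub0v.
have sjR : (s j :&: T <= R)%VS.
  by apply: contraT => /minj; rewrite ltnn.
have ltjn : (j < n)%N.
  apply: minj; apply/negP => /subvP sTR; apply: xR; apply: sTR.
  by rewrite memv_cap xT; case: hs => _ -> _; rewrite memvf.
have cj := chief_s ltjn; have [hS1 hS sSS _ hSS] := cj.
have {nsj} /subvPn[e] := nsj; set E := (_ :&: T)%VS => eE eR.
have iE : ideal br E by apply: idealI.
have sES : (E <= s j.+1)%VS := capvSl _ _.
have sET : (E <= T)%VS := capvSr _ _.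
have [M [K [hM hK eK]]] : exists M K, [/\ crown_max br A B M, is_core br M K & e \notin K].
  apply: NNPP => nMK; case/negP: eR; apply/hR => M K hM hK.
  by apply: contraT => eK; case: nMK; exists M, K.
have [CM cCK isoCK sRK] := crown_core hC hM hK.
have [_ iK sKC _ hCK] := cCK.
have eqC : (K + E)%VS = C.
  have [|eqK|//] := hCK (K + E)%VS (idealD iK iE) (addvSl _ _).
    by rewrite subv_add sKC (subv_trans sET).
  by case/negP: eK; rewrite -eqK (subvP (addvSr _ _)).
have isoCK' := L_iso_sym hA iC iK sKC isoCK.
(* [C] is also the centralizer of C/K, and [C] is [K + E]; so it suffices that [s j, E] lies in
   [s j :&: T], hence in [R] and in [K]. *)
have sSC : (s j <= C)%VS.
  have hZ := L_iso_centr iC hB isoCK' (crown_centr hC).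
  apply/subvP=> y yS; apply/hZ => c; rewrite -eqC => /memv_addP[k kK [a aE ->]].
  rewrite brDr; apply: memvD; first exact: iK.
  by rewrite (subvP sRK) // (subvP sjR) // memv_cap idealr // iT // (subvP sET).
have eqS : (s j + E)%VS = s j.+1.
  have [|eqK|//] := hSS (s j + E)%VS (idealD hS iE) (addvSl _ _).
    by rewrite subv_add sSS.
  case/negP: eR; rewrite (subvP sjR) // memv_cap.
  by rewrite (subvP sET) // -eqK (subvP (addvSr _ _)).
have sS1C : (s j.+1 <= C)%VS by rewrite -eqS subv_add sSC (subv_trans sET).
have [S [hSS' sRS SY sSYR]] := crown_supplement hC hS1 sS1C.
(* Otherwise [e] is [t + a] with [t] in [S] and [a] in [s j]. Then [t] lies in [S :&: s j.+1], so in
   [R]; hence [a] lies in [T :&: s j], so in [R] too, and [e] would be in [R]. *)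
have nS : ~ (s j.+1 <= S + s j)%VS.
  move=> /subvP/(_ e (subvP sES _ eE))/memv_addP[t tS [a aS eta]].
  have tR : t \in R.
    rewrite (subvP sSYR) // memv_cap tS /= -(addrK a t) -eta.
    by apply: memvB; [exact: (subvP sES) | exact: (subvP sSS)].
  have aR : a \in R.
    rewrite (subvP sjR) // memv_cap aS /= -(addKr t a) -eta addrC.
    by apply: memvB; [exact: (subvP sET) | exact: (subvP sRT)].
  by case/negP: eR; rewrite eta memvD.
have [|M' hM' sSM'] := exists_maxsub (subalgD hSS' hS).
  by apply/eqP => eqf; apply: nS; rewrite eqf subvf.
have sjM' : (s j <= M')%VS := subv_trans (addvSr _ _) sSM'.
have nM' : ~ (s j.+1 <= M')%VS.
  move=> sjM; case: hM' => _ /eqP nf _; apply: nf; apply/eqP.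
  by rewrite eqEsubv subvf -SY subv_add sjM (subv_trans (addvSl _ _) sSM').
have nfr : ~ frattini_factor br (s j.+1) (s j).
  by apply/(frattini_factorN cj); exists M'.
have sEKS : (E :&: K <= s j)%VS.
  have [|<-|eqS'] := hSS (s j + (E :&: K))%VS (idealD hS (idealI iE iK)) (addvSl _ _).
  - by rewrite subv_add sSS (subv_trans (capvSl _ _)).
  - exact: addvSr.
  have: e \in s j.+1 := subvP sES _ eE.
  rewrite -eqS' => /memv_addP[a aS [k /memv_capP[kE kK] eak]].
  case/negP: eK; rewrite eak memvD // (subvP sRK) // (subvP sjR) // memv_cap aS /=.
  by rewrite -(addrK k a) -eak memvB ?(subvP sET).
(* The chain of isomorphisms is [s j.+1] over [s j], then E over [E :&: K], then C/K, then A/B. *)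
have crj : crown_of br (s j.+1) (s j) C R.
  apply: (crown_of_iso hC) => //.
    exists M'; split=> //; split; first by case: hM'.
      by rewrite addvC maxsub_add.
    by rewrite subv_cap sSS.
  apply: L_iso_trans isoCK'.
  have isoE : L_iso br E (E :&: K) (s j.+1) (s j).
    apply: L_iso_id => //; last by rewrite addvC eqS.
    rewrite subv_cap capvSl (subv_trans _ sRK) // (subv_trans _ sjR) //.
    by rewrite subv_cap capvSr (subv_trans (capvSl _ _)).
  apply: L_iso_trans (L_iso_sym _ _ _ _ isoE) _ => //.
  apply: L_iso_id; rewrite ?capvSr // ?(subv_trans sET) //.
  by rewrite addvC eqC.
have [hMj sMj nMj] := hMs j ltjn nfr.
have [Kj hKj] := core_exists (Ms j); have [_ sKMj maxKj] := hKj.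
apply: nMj; rewrite -eqS subv_add sMj /= (subv_trans sET) //.
by apply: subv_trans sKMj; apply/subvP=> y /hT; apply; right; exists j.
Qed.


Lemma prefrattini_of_choice Ms C R K : prefrattini_choice Ms -> is_crown br C R ->
    (forall x, x \in K <-> forall i, (i < n)%N ->
      ~ frattini_factor br (s i.+1) (s i) ->
      crown_of br (s i.+1) (s i) C R -> x \in Ms i) ->
  complement_quot br C R K.
Proof.
move=> hMs hCR hK; have [A [B hC]] := hCR.
have core_of i : (i < n)%N -> ~ frattini_factor br (s i.+1) (s i) ->
    crown_of br (s i.+1) (s i) C R -> forall N, is_core br (Ms i) N ->
  (C :&: Ms i)%VS = N /\ (R <= N)%VS.
  move=> ltin nfr cri N hN; have [hMi sMi nMi] := hMs i ltin nfr.
  have hcM := maxsub_crown_max (chief_s ltin) hMi sMi nMi.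
  by have [] := crown_core cri hcM hN.
have sRK : (R <= K)%VS.
  apply/subvP=> x xR; apply/hK => i ltin nfr cri.
  have [N hN] := core_exists (Ms i); have [eN /subvP sRN] := core_of i ltin nfr cri N hN.
  by case: hN => _ /subvP sNM _; apply/sNM/sRN.
split=> //.
- move=> x y /hK xK /hK yK; apply/hK => i ltin nfr cri.
  by have [[hMi _ _] _ _] := hMs i ltin nfr; apply: hMi; [apply: xK | apply: yK].
- apply/eqP; rewrite eqEsubv subvf; apply/subvP=> x _.
  (* Downward induction on [j], with [d] equal to [n - j]: [x] is corrected by elements of [C] until
     it enters [Ms i] for all relevant [i >= j]. The correction made at [j] lies in [s j.+1], hence
     in [Ms i] for each relevant [i > j], so it keeps the memberships already obtained. *)
  suff H d j : (j + d = n)%N -> exists2 c, c \in C &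
      forall i, (j <= i < n)%N -> ~ frattini_factor br (s i.+1) (s i) ->
        crown_of br (s i.+1) (s i) C R -> x - c \in Ms i.
    have [c cC xc] := H n 0%N (add0n n).
    by rewrite -(subrK c x); apply: memv_add => //; apply/hK => i ltin; apply: xc.
  elim: d j => [|d IH] j.
    rewrite addn0 => ->; exists 0; rewrite ?mem0v // => i /andP[lni].
    by rewrite ltnNge lni.
  rewrite addnS -addSn => ejd; have [c cC xc] := IH _ ejd.
  have ltjn : (j < n)%N by rewrite -ejd leq_addr.
  case: (classic (~ frattini_factor br (s j.+1) (s j) /\
                  crown_of br (s j.+1) (s j) C R)) => [[nfr crj]|nj]; last first.
    exists c => // i; rewrite leq_eqVlt => /andP[/orP[/eqP <-|ltji] ltin] nfr cri.
      by case: nj.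
    by apply: xc; rewrite ?ltji.
  have [hMj sMj nMj] := hMs j ltjn nfr; have [hS1 _ _ _ _] := chief_s ltjn.
  have sSC := chief_sub_centr (chief_s ltjn) (crown_centr crj).
  have : x - c \in (Ms j + s j.+1)%VS by rewrite maxsub_add ?memvf.
  case/memv_addP=> m mM [d' dS exc].
  exists (c + d'); first by apply: memvD => //; apply: (subvP sSC).
  have {}exc : x - (c + d') = m by rewrite opprD addrA exc addrK.
  move=> i; rewrite leq_eqVlt => /andP[/orP[/eqP <-|ltji] ltin] nfri cri.
    by rewrite exc.
  rewrite opprD addrA; apply: memvB; first by apply: xc; rewrite ?ltji.
  have [_ sMi _] := hMs i ltin nfri.
  by rewrite (subvP sMi) // (subvP (series_le _) _ dS) // ltji ltnW.
apply/eqP; rewrite eqEsubv subv_cap sRK (crown_sub hC) !andbT.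
(* On [C] each relevant [Ms i] coincides with its core, so the key fact about cores applies. *)
apply/subvP=> x /memv_capP[/hK xK xC].
apply: (crown_meet_cores hMs hCR xC) => i ltin nfr cri N hN.
by have [<- _] := core_of i ltin nfr cri N hN; rewrite memv_cap xC xK.
Qed.

(** For a subalgebra [S] above [H + K], the meet [S :&: C] is preserved by [H] and, C/R being
    abelian, by [C]. As an ideal between [K] and [C] it is one of them, which forces [S] to be
    [H + K] or L. *)
Lemma maxsub_of_complement A B C R H M K : crown_of br A B C R ->
    complement_quot br C R H -> crown_max br A B M -> is_core br M K ->
    ~ (C <= K)%VS ->
  maxsub br (H + K) /\ ((H + K) :&: C)%VS = K.
Proof.
move=> hC [hH sRH HC HR] hM hK nCK.
have [_ cCK _ sRK] := crown_core hC hM hK.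
have [iC iK sKC _ hCK] := cCK.
have eqC : ((H + K) :&: C)%VS = K.
  by rewrite addvC -vspace_modl // HR (addv_idPl sRK).
have sHK := subalgD hH iK.
split=> //; split=> //.
  by apply/eqP => e; apply: nCK; rewrite -eqC e capfv.
move=> S hS sHKS; have sHS := subv_trans (addvSl _ _) sHKS.
have iSC : ideal br (S :&: C).
  apply: (ideal_of_add HC) => x y xU /memv_capP[yS yC]; rewrite memv_cap.
    by rewrite hS ?iC // (subvP sHS).
  by rewrite iC // (subvP sHS) // (subvP sRH) // (crown_abelian hC).
have [|eK|eSC] := hCK _ iSC _ (capvSr _ _).
- by rewrite subv_cap sKC (subv_trans (addvSr _ _) sHKS).
- by left; rewrite -eK (capvC S) vspace_modl // HC capfv.
by right; apply/eqP; rewrite eqEsubv subvf -HC subv_add sHS -eSC capvSl.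
Qed.

End ChiefSeries.

End LieAlgebra.

(** * Prefrattini subalgebras and complements of crowns *)

Theorem theorem3p6 (F : fieldType) (L : vectType F) (br : L -> L -> L)
  (hL : lie_algebra br) (hsol : solvable br)
  (n : nat) (s : nat -> {vspace L}) (hs : chief_series br n s)
  (B : {vspace L}) :
  prefrattini br n s B <->
  exists K : {vspace L} -> {vspace L} -> {vspace L},
    (forall C R, is_crown br C R -> complement_quot br C R (K C R)) /\
    (forall x, x \in B <-> (forall C R, is_crown br C R -> x \in K C R)).
Proof.
have [_ _ chief_s] := hs.
split=> [[Ms [hMs hB]]|[K [hK hB]]].
  (* The complement attached to a crown is the meet of those [Ms i] whose factor has that crown. *)
  have [K hK] := functional_choice _ (fun CR : {vspace L} * {vspace L} =>
    exists_bigcap (fun U => exists i, [/\ (i < n)%N,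
      ~ frattini_factor br (s i.+1) (s i),
      crown_of br (s i.+1) (s i) CR.1 CR.2 & U = Ms i])).
  have {}hK C R x : x \in K (C, R) <-> forall i, (i < n)%N ->
      ~ frattini_factor br (s i.+1) (s i) ->
      crown_of br (s i.+1) (s i) C R -> x \in Ms i.
    rewrite hK; split=> [H i ltin nfr cri|H U [i [ltin nfr cri ->]]].
      by apply: H; exists i.
    exact: H.
  exists (fun C R => K (C, R)); split=> [C R hC|x].
    exact: (prefrattini_of_choice hL hsol hs hMs hC (hK C R)).
  split=> [/hB H C R _|H]; first by apply/hK => i ltin nfr _; apply: H.
  apply/hB => i ltin nfr; have [C [R hC]] := factor_crown hL hs ltin nfr.
  by have /hK := H C R (is_crown_of hC); apply.
(* An auxiliary choice, needed for its cores [Ns i]. Indices outside the family get the dummy value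
   [fullv]. *)
have [Ms hMs] : exists Ms, prefrattini_choice br n s Ms.
  apply: (functional_choice (fun i M => (i < n)%N -> ~ frattini_factor br (s i.+1) (s i) ->
    [/\ maxsub br M, (s i <= M)%VS & ~ (s i.+1 <= M)%VS])) => i.
  case: (classic ((i < n)%N /\ ~ frattini_factor br (s i.+1) (s i))).
    by move=> [ltin /(frattini_factorN hL (chief_s i ltin))[M hM]]; exists M.
  by move=> ni; exists fullv => ltin nfr; case: ni.
have [Ns hNs] := functional_choice _ (fun i => core_exists hL (Ms i)).
have [Ks hKs] : exists Ks : nat -> {vspace L}, forall i, (i < n)%N ->
    ~ frattini_factor br (s i.+1) (s i) -> exists C R,
    crown_of br (s i.+1) (s i) C R /\ Ks i = K C R.
  apply: (functional_choice (fun i Ki => (i < n)%N ->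
    ~ frattini_factor br (s i.+1) (s i) -> exists C R,
    crown_of br (s i.+1) (s i) C R /\ Ki = K C R)) => i.
  case: (classic ((i < n)%N /\ ~ frattini_factor br (s i.+1) (s i))).
    move=> [ltin nfr]; have [C [R hC]] := factor_crown hL hs ltin nfr.
    by exists (K C R) => _ _; exists C, R.
  by move=> ni; exists fullv => ltin nfr; case: ni.
have step i C R : (i < n)%N -> ~ frattini_factor br (s i.+1) (s i) ->
    crown_of br (s i.+1) (s i) C R ->
  [/\ Ks i = K C R, (R <= Ns i)%VS, ((Ks i + Ns i) :&: C)%VS = Ns i,
      maxsub br (Ks i + Ns i) & (s i <= Ns i)%VS /\ ~ (s i.+1 <= Ks i + Ns i)%VS].
  move=> ltin nfr hC.
  have [C' [R' [hC' eK]]] := hKs i ltin nfr; have [eC eR] := crown_uniq hC' hC.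
  rewrite {}eC {}eR in eK => {hC' C' R'}.
  have [hMi sMi nMi] := hMs i ltin nfr.
  have [_ sNM maxN] := hNs i.
  have [hS1 hS _ _ _] := chief_s i ltin.
  have hcM := maxsub_crown_max hL hsol (chief_s i ltin) hMi sMi nMi.
  have [CM cCN _ sRN] := crown_core hL hsol hC hcM (hNs i).
  have sSC := chief_sub_centr hL hsol (chief_s i ltin) (crown_centr hL hsol hC).
  have nCN : ~ (C <= Ns i)%VS.
    by move=> sCN; apply: nMi; apply: subv_trans sSC (subv_trans sCN sNM).
  have cK := hK C R (is_crown_of hC); rewrite -eK in cK.
  have [mKN eqN] := maxsub_of_complement hL hsol hC cK hcM (hNs i) nCN.
  split=> //; split; first exact: maxN.
  move=> sSK; apply: nMi; apply: subv_trans sNM.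
  by rewrite -eqN subv_cap sSK.
(* Complement plus core is maximal and meets [C] in [Ns i], so it still avoids [s i.+1]. *)
exists (fun i => Ks i + Ns i)%VS; split=> [i ltin nfr|x].
  have [C [R [hC _]]] := hKs i ltin nfr.
  have [_ _ _ mKN [sSN nS]] := step i C R ltin nfr hC.
  by split=> //; apply: subv_trans (addvSr _ _).
split=> [/hB H i ltin nfr|H].
  have [C [R [hC eK]]] := hKs i ltin nfr.
  rewrite (subvP (addvSl _ _)) // eK; apply: H.
  exact: is_crown_of hC.
apply/hB => C R hC; have [_ sRK KC KR] := hK C R hC.
(* With [x] equal to [h + c], the part [c] is [x - h], which lies in [Ks i + Ns i] and in [C], hence
   in every relevant core [Ns i]; the key fact puts [c] in [R], so [x] is in the complement. *)
have /memv_addP[h hKx [c cC ex]] : x \in (K C R + C)%VS by rewrite KC memvf.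
rewrite ex memvD // (subvP sRK) //.
apply: (crown_meet_cores hL hsol hs hMs hC cC) => i ltin nfr cri N hN.
have [eK sRN eqN _ _] := step i C R ltin nfr cri.
have <- : Ns i = N.
  have [[iN sN mN] [iN' sN' mN']] := (hNs i, hN).
  by apply/eqP; rewrite eqEsubv mN' ?mN.
rewrite -eqN memv_cap cC andbT -(addKr h c) -ex.
by rewrite memvD ?H // memvN eK (subvP (addvSl _ _)).
Qed.
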